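(* Let $\kappa>0$, $p\ge 1$, $x,\beta\in\mathbb{R}^p$ and $y\in\{-1,+1\}$. Then $$\left(1+e^{-y x^\top\beta}\right)^{-\kappa}=\int_0^\infty\int_0^\infty \frac{1}{\sqrt{2\pi\lambda}}\exp\left\{-\frac{1}{2\lambda}\left(z-yx^\top\beta-\frac12(1-\kappa)\lambda\right)^2\right\}q_{1,\kappa}(\lambda)\,d\lambda\,dz,$$ where $q_{1,\kappa}$ is the Polya density $q_{a,b}$ with $a=1$, $b=\kappa$.
   Context: For $a,b>0$, the Polya density $q_{a,b}$ on $(0,\infty)$ is $$q_{a,b}(\lambda)=\sum_{k=0}^\infty w_k e^{-\frac12\psi_k\lambda},\qquad \psi_k=(a+k)(b+k),$$ with, for $\delta=(a+b)/2$ and $\theta=(a-b)/2$, $$w_k=\binom{-2\delta}{k}\frac{\delta+k}{B(\delta+\theta,\delta-\theta)}=\frac{(-1)^k(2\delta)(2\delta+1)\cdots(2\delta+k-1)}{k!}\cdot\frac{\delta+k}{B(\delta+\theta,\delta-\theta)},$$ where $B$ is the Beta function (so $B(\delta+\theta,\delta-\theta)=B(a,b)$). Equivalently, $q_{a,b}$ is the density of $\sum_{k=0}^\infty 2\psi_k^{-1}\epsilon_k$, where the $\epsilon_k$ are i.i.d. exponential random variables with mean $1$. *)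

(* Defs.v *)
From mathcomp Require Import all_boot all_order all_algebra.
From mathcomp Require Import all_classical all_reals all_analysis.

Set Implicit Arguments.
Unset Strict Implicit.
Unset Printing Implicit Defensive.

Import Order.TTheory GRing.Theory Num.Theory.
Import numFieldNormedType.Exports.

Local Open Scope classical_set_scope.
Local Open Scope ring_scope.

(* binom(r, k) = r (r - 1) ... (r - k + 1) / k! for a real upper argument. *)
Definition real_binomial (R : realType) (r : R) (k : nat) : R :=
  (\prod_(i < k) (r - i%:R)) / k`!%:R.

Lemma real_binomialN (R : realType) (r : R) (k : nat) :
  real_binomial (- r) k = (-1) ^+ k * (\prod_(i < k) (r + i%:R)) / k`!%:R.
Proof.
rewrite /real_binomial; congr (_ / _).
under eq_bigr => i _ do rewrite -opprD -mulN1r.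
by rewrite big_split /= prodr_const card_ord.
Qed.

(* Euler's Beta function at real arguments; [beta_fun] of MathComp-Analysis only
   takes natural ones. The integral converges for a, b > 0. *)
Definition Beta (R : realType) (a b : R) : R :=
  \int[@lebesgue_measure R]_(t in `]0, 1[)
    (t `^ (a - 1) * (1 - t) `^ (b - 1)).

Definition polya_psi (R : realType) (a b : R) (k : nat) : R :=
  (a + k%:R) * (b + k%:R).

Definition polya_weight (R : realType) (a b : R) (k : nat) : R :=
  let delta := (a + b) / 2 in
  let theta := (a - b) / 2 in
  real_binomial (- (2 * delta)) k *
    ((delta + k%:R) / Beta (delta + theta) (delta - theta)).

(* For a, b > 0 the series converges absolutely at every lambda > 0; only these
   values of lambda are meaningful. *)
Definition polya_density (R : realType) (a b lambda : R) : R :=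
  limn (series (fun k : nat =>
    polya_weight a b k * expR (- (1 / 2) * polya_psi a b k * lambda))).

(* Main.v *)
Require Import Defs.
From HB Require Import structures.
From mathcomp Require Import all_boot all_order all_algebra.
From mathcomp Require Import all_classical all_reals all_analysis.
From mathcomp Require Import ring lra measurable_realfun.
Import Order.TTheory GRing.Theory Num.Theory.
Import numFieldNormedType.Exports.
Local Open Scope classical_set_scope.
Local Open Scope ring_scope.


(** With [u = z - y x^T beta], [delta = (a + b) / 2] and [theta = (a - b) / 2],
    the identity [polya_psi a b k + theta ^ 2 = (delta + k) ^ 2] turns the k-th
    term of the inner integrand into a multiple of
    [(2 pi l)^(-1/2) exp(-u^2 / (2 l) - (delta + k)^2 l / 2)], whose integral
    over [l > 0] is [exp(-(delta + k) |u|) / (delta + k)]. For [u <> 0] the sum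
    and the integral may be exchanged, and the binomial series in [exp(-|u|)]
    shows that the inner integral is the generalized logistic density
    [exp(a u) (1 + exp u)^(-(a + b)) / B(a, b)]. For [a = 1] and [b = kappa] it
    is the derivative of [-(1 + exp u)^(-kappa)], which gives the outer
    integral; the exceptional point [u = 0] has measure zero. *)

(** * The binomial series with a real exponent *)

Lemma real_binomialS {R : realType} (r : R) (k : nat) :
  k.+1%:R * real_binomial r k.+1 = (r - k%:R) * real_binomial r k.
Proof.
rewrite /real_binomial big_ord_recr/= factS natrM invfM.
set P := \prod_(i < k) _; have k0 : k.+1%:R != 0 :> R by rewrite pnatr_eq0.
transitivity (k.+1%:R / k.+1%:R * (P * (r - k%:R) / k`!%:R)); first by ring.
by rewrite divff// mul1r mulrCA mulrA.
Qed.

Lemma real_binomial_diffs {R : realType} (r : R) :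
  pseries_diffs (real_binomial r) = r *: real_binomial (r - 1).
Proof.
apply/funext => k; rewrite /pseries_diffs fctE /real_binomial.
rewrite big_ord_recl/= subr0 factS natrM invfM.
have -> : \prod_(i < k) (r - 1 - i%:R) = \prod_(i < k) (r - (bump 0 i)%:R).
  by apply: eq_bigr => i _; rewrite /bump/= natrD; ring.
set P := \prod_(i < k) _; have k0 : k.+1%:R != 0 :> R by rewrite pnatr_eq0.
transitivity (k.+1%:R / k.+1%:R * (r * (P / k`!%:R))); first by ring.
by rewrite divff// mul1r.
Qed.

(** After multiplication by [k + 1], both sides equal [r * real_binomial (r - 1) k], by the ratio
    recurrence and the formula for the formal derivative. *)
Lemma real_binomial_pascal {R : realType} (r : R) (k : nat) :
  real_binomial r k.+1 = real_binomial (r - 1) k.+1 + real_binomial (r - 1) k.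
Proof.
have k0 : k.+1%:R != 0 :> R by rewrite pnatr_eq0.
apply: (mulfI k0); rewrite mulrDr !real_binomialS.
have /(congr1 (fun f => f k)) := real_binomial_diffs r.
rewrite /pseries_diffs real_binomialS /= fctE => ->.
by rewrite -natr1 /GRing.scale/=; ring.
Qed.

(* By [real_binomialS], [|real_binomial r k| rho ^ k] is eventually
   nonincreasing for every [rho < 1]. *)
Lemma is_cvg_pseries_real_binomial {R : realType} (r z : R) :
  `|z| < 1 -> cvgn (pseries (real_binomial r) z).
Proof.
move=> z1; pose rho := (`|z| + 1) / 2.
have zrho : `|z| < rho by rewrite /rho; lra.
have rho1 : rho < 1 by rewrite /rho; lra.
have rho0 : 0 < rho by rewrite (le_lt_trans _ zrho).
(* For [n >= N] one has [|r| <= (1 - rho) n], hence [|r - n| rho <= |r| + n rho <= n]; this keeps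
   the ratio of consecutive terms of [u] at most 1. *)
pose N := (Num.truncn (`|r| / (1 - rho))).+1.
pose u k := `|real_binomial r (k + N)| * rho ^+ (k + N).
have uS k : u k.+1 <= u k.
  rewrite /u addSn exprS mulrA ler_wpM2r ?exprn_ge0 ?(ltW rho0)//.
  set n := (k + N)%N.
  have n0 : 0 < n.+1%:R :> R by rewrite ltr0n.
  rewrite -(ler_pM2l n0) mulrA -[X in X * `|_|](gtr0_norm n0) -normrM.
  rewrite real_binomialS normrM mulrAC ler_wpM2r//.
  have rn : `|r| / (1 - rho) <= n%:R.
    by rewrite (le_trans (ltW (truncnS_gt _)))// ler_nat leq_addl.
  rewrite ler_pdivrMr ?subr_gt0// in rn.
  have : `|r - n%:R| <= `|r| + n%:R.
    by rewrite (le_trans (ler_normB _ _))// normr_nat.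
  move=> /(ler_wpM2r (ltW rho0)) /le_trans; apply.
  have : `|r| * rho <= `|r| by rewrite ler_piMr// ltW.
  by rewrite -natr1; lra.
have u_le k : u k <= u 0%N.
  by elim: k => // k; exact: le_trans (uS k).
apply: normed_cvg.
rewrite /normed_series_of/= -(is_cvg_series_restrict N).
suff : cvgn (series (fun k => `|real_binomial r (k + N) * z ^+ (k + N)|)).
  move=> /cvg_ex[/= l hl]; apply/cvg_ex; exists l; rewrite -(cvg_shiftn N)/=.
  apply: cvg_trans hl; apply: near_eq_cvg; apply: nearW => n; rewrite /series/=.
  have := @big_addn _ 0 +%R 0 (n + N) N xpredT
    (fun k => `|real_binomial r k * z ^+ k|).
  by rewrite add0n addnK => ->.
have rz : `| `|z| / rho| < 1.
  by rewrite ger0_norm ?divr_ge0 ?(ltW rho0)// ltr_pdivrMr// mul1r.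
(* The n-th term of the tail is [u n * (|z| / rho) ^ (n + N)]. Since [u n <= u 0] and
   [|z| / rho < 1], a geometric series dominates. *)
apply: (@series_le_cvg _ _ (geometric (u 0%N) (`|z| / rho))) => [//|n|n|] /=.
- by rewrite !mulr_ge0 ?exprn_ge0 ?divr_ge0 ?normr_ge0 ?(ltW rho0).
- rewrite normrM normrX.
  rewrite -[X in X ^+ (n + N)](divfK (lt0r_neq0 rho0)) exprMn.
  rewrite [leLHS]mulrCA [leLHS]mulrC.
  apply: ler_pM; rewrite ?mulr_ge0 ?exprn_ge0 ?divr_ge0 ?(ltW rho0)//.
    exact: u_le.
  by rewrite exprD ler_piMr ?exprn_ge0 ?exprn_ile1 ?divr_ge0 ?(ltW rho0)//
    ler_pdivrMr// mul1r ltW.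
- exact: is_cvg_geometric_series.
Qed.

(** Termwise differentiation at a point inside the radius [K], halfway between [|x|] and 1. Each
    formal derivative of a binomial series is a multiple of one with exponent lowered by 1, so the
    first two also converge at [K]. *)
Lemma is_derive_binomial_series {R : realType} (r x : R) : `|x| < 1 ->
  is_derive x 1 (fun x => limn (pseries (real_binomial r) x))
    (r * limn (pseries (real_binomial (r - 1)) x)).
Proof.
move=> x1; pose K := (`|x| + 1) / 2.
have K0 : 0 <= K by rewrite divr_ge0// addr_ge0.
have xK : `|x| < `|K| by rewrite (ger0_norm K0) /K; lra.
have K1 : `|K| < 1 by rewrite (ger0_norm K0) /K; lra.
have diffs s y : pseries (pseries_diffs (real_binomial s)) y =
    s *: pseries (real_binomial (s - 1)) y.
  rewrite real_binomial_diffs /pseries -seriesZ; congr series.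
  by apply/funext => k; rewrite !fctE scalerAl.
have <- : limn (pseries (pseries_diffs (real_binomial r)) x) =
    r * limn (pseries (real_binomial (r - 1)) x).
  by rewrite diffs limZl_tmp//; exact: is_cvg_pseries_real_binomial.
have cvgb s := is_cvg_pseries_real_binomial s K K1.
apply: (@pseries_snd_diffs _ _ K) => //.
- by rewrite diffs; exact: is_cvgZl_tmp.
- rewrite real_binomial_diffs.
  rewrite (_ : pseries_diffs _ = r *: pseries_diffs (real_binomial (r - 1))).
    rewrite real_binomial_diffs.
    rewrite (_ : pseries _ _ =
        (r * (r - 1)) *: pseries (real_binomial (r - 1 - 1)) K).
      exact: is_cvgZl_tmp.
    rewrite /pseries -seriesZ; congr series; apply/funext => k.
    by rewrite !fctE /GRing.scale/=; ring.
  by apply/funext => k; exact: mulrCA.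
Qed.

(** Pascal's rule splits [n + 1] terms for [r] into [n + 1] terms for [r - 1] plus [x] times [n]
    terms for [r - 1]; then let [n] grow. *)
Lemma binomial_series_pascal {R : realType} (r x : R) : `|x| < 1 ->
  limn (pseries (real_binomial r) x) =
  (1 + x) * limn (pseries (real_binomial (r - 1)) x).
Proof.
move=> x1; apply/cvg_lim => //.
have cb := is_cvg_pseries_real_binomial (r - 1) x x1.
rewrite -cvg_shiftS /=.
rewrite (_ : (fun n => _) = (fun n =>
    pseries (real_binomial (r - 1)) x n.+1 +
    x * pseries (real_binomial (r - 1)) x n)); last first.
  apply/funext => n; rewrite /pseries /series/= !big_nat_recl// mulr_sumr.
  rewrite -addrA -big_split/=; congr (_ + _).
    by rewrite /real_binomial !big_ord0.
  by apply: eq_bigr => i _; rewrite real_binomial_pascal exprS; ring.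
rewrite mulrDl mul1r; apply: cvgD; first by rewrite cvg_shiftS.
by apply: cvgM; [exact: cvg_cst|exact: cb].
Qed.

(* [(1 + t x)^(-r)] times the series at [t x] has zero derivative in [t]. *)
Lemma binomial_series {R : realType} (r x : R) : `|x| < 1 ->
  limn (pseries (real_binomial r) x) = (1 + x) `^ r.
Proof.
move=> x1.
pose h (t : R) :=
  (1 + t * x) `^ (- r) * limn (pseries (real_binomial r) (t * x)).
have tx (t : R) : t \in `[0, 1] -> `|t * x| < 1.
  rewrite in_itv/= => /andP[t0 t1]; rewrite normrM ger0_norm//.
  by rewrite (le_lt_trans _ x1)// ler_piMl.
have tx0 (t : R) : t \in `[0, 1] -> 0 < 1 + t * x.
  by move=> /tx; rewrite ltr_norml => /andP[+ _]; lra.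
have dh (t : R) : t \in `[0, 1] -> is_derive t 1 h 0.
  move=> t01.
  have dtx : is_derive t 1 (fun t => t * x) x.
    by apply: is_derive_eq; rewrite scaler0 add0r /GRing.scale/= mulr1.
  have d1tx : is_derive t 1 (fun t => 1 + t * x) x.
    by have := is_deriveD (is_derive_cst (1:R) t 1) dtx; rewrite add0r.
  have dS := is_derive_binomial_series r _ (tx t t01).
  have dSt := @is_derive1_comp _ _ (fun t => t * x) t _ _ dS dtx.
  have dp := @is_derive1_powR _ (- r) _ (tx0 t t01).
  have dpt := @is_derive1_comp _ _ (fun t => 1 + t * x) t _ _ dp d1tx.
  have := is_deriveM dpt dSt.
  rewrite /h; move/is_derive_eq; apply.
  (* Writing the series for [r] as [1 + t x] times the series for [r - 1] makes the two terms of the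
     product rule cancel. *)
  rewrite /GRing.scale/= (binomial_series_pascal r) ?tx//.
  rewrite powRB ?powRr1 ?(ltW (tx0 _ _))//; last first.
    by rewrite (gt_eqF (tx0 _ t01)) implybT.
  by field; rewrite gt_eqF// tx0.
have h01 : h 1 = h 0.
  have hc : {within `[0, 1], continuous h}.
    by apply: derivable_within_continuous => t /dh[].
  have dh' (t : R) : t \in `]0, 1[ -> is_derive t 1 h 0.
    by move=> t01; apply: dh; exact: subset_itv_oo_cc.
  have [t _] := @MVT_segment R h (fun=> 0) 0 1 ler01 dh' hc.
  by rewrite mul0r => /eqP; rewrite subr_eq0 => /eqP.
have := h01; rewrite /h mul1r mul0r addr0 powR1 mul1r.
have -> : limn (pseries (real_binomial r) 0) = 1.
  apply/cvg_lim => //; rewrite -cvg_shiftS/=.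
  apply: cvg_near_cst; apply: nearW => n.
  rewrite /pseries /series/= big_nat_recl// big1 => [|i _].
    by rewrite /real_binomial big_ord0 expr0 fact0 divr1 !mulr1 addr0.
  by rewrite exprS mul0r mulr0.
have x0 : 0 < 1 + x.
  by have := tx0 1; rewrite mul1r; apply; rewrite in_itv/= ler01 lexx.
rewrite powRN => /(canRL (mulKf _)) ->; rewrite ?mulr1 ?invrK//.
by rewrite invr_eq0 gt_eqF// powR_gt0.
Qed.

(** * The fundamental theorem of calculus on open and unbounded intervals *)

(** The fundamental theorem holds on each compact interval of the exhaustion. Since [f] is
    nonnegative, monotone convergence passes to the union, and the boundary values converge to [A]
    and [B]. *)
Lemma ge0_FTC2_bigcup {R : realType} (f F : R -> R) (a b : R^nat) (A B : R)
    (D := \bigcup_n `[a n, b n]%classic) :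
  (forall n, a n < b n) -> (forall n, a n.+1 <= a n) ->
  (forall n, b n <= b n.+1) ->
  (forall x, D x -> 0 <= f x) -> (forall x, D x -> {for x, continuous f}) ->
  (forall x, D x -> is_derive x 1 F (f x)) ->
  F (a n) @[n --> \oo] --> A -> F (b n) @[n --> \oo] --> B ->
  (\int[@lebesgue_measure R]_(x in D) (f x)%:E = (B - A)%:E)%E.
Proof.
move=> ab aS bS f0 cf dF FA FB.
have DE n x : `[a n, b n]%classic x -> D x by exists n.
have Fc x : D x -> {for x, continuous F}.
  by move=> /dF[Fx _]; exact/differentiable_continuous/derivable1_diffP.
have wf n : {within `[a n, b n], continuous f}.
  by apply: continuous_in_subspaceT => x /set_mem/DE; exact: cf.
have I n : (\int[@lebesgue_measure R]_(x in `[a n, b n]) (f x)%:E =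
    (F (b n) - F (a n))%:E)%E.
  rewrite (@continuous_FTC2 _ f F)//.
    split => [x xab||].
    - by have [] := dF x (DE n x (subset_itv_oo_cc xab)).
    - apply: cvg_at_right_filter; apply: Fc; apply: (DE n).
      by rewrite /= in_itv/= lexx ltW.
    - apply: cvg_at_left_filter; apply: Fc; apply: (DE n).
      by rewrite /= in_itv/= lexx ltW.
  move=> x xab; rewrite derive1E.
  by have [_] := dF x (DE n x (subset_itv_oo_cc xab)).
have cvgI : (\int[@lebesgue_measure R]_(x in `[a n, b n]) (f x)%:E)%E
    @[n --> \oo] --> (B - A)%:E.
  under eq_fun do rewrite I.
  by apply: cvg_EFin; [exact: nearW|exact: cvgB].
apply: (cvg_unique _ _ cvgI) => //.
apply: ge0_nondecreasing_set_cvg_integral => [|//|n|n x Dx] /=.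
- apply/nondecreasing_seqP => n; apply/subsetPset => x/=.
  rewrite !in_itv/= => /andP[ax xb].
  by rewrite (le_trans (aS n))// (le_trans xb).
- by apply/measurable_EFinP; exact: subspace_continuous_measurable_fun.
- by rewrite lee_fin f0//; exact: DE Dx.
Qed.

Lemma ge0_FTC2_0y {R : realType} (f F : R -> R) (A B : R) :
  (forall x : R, 0 < x -> 0 <= f x) ->
  (forall x : R, 0 < x -> {for x, continuous f}) ->
  (forall x : R, 0 < x -> is_derive x 1 F (f x)) ->
  F x @[x --> 0^'+] --> A -> F x @[x --> +oo] --> B ->
  (\int[@lebesgue_measure R]_(x in `]0%R, +oo[) (f x)%:E = (B - A)%:E)%E.
Proof.
move=> f0 cf dF FA FB.
(* The right endpoints start at 2, so that the interval is nondegenerate already for [n = 0], where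
   the left endpoint is 1. *)
have DE : `]0, +oo[%classic = \bigcup_n `[n.+1%:R^-1, n.+2%:R]%classic :> set R.
  apply/seteqP; split=> [x/=|x [n _]/=]; rewrite !in_itv/= ?andbT; last first.
    by move=> /andP[+ _]; apply: lt_le_trans; rewrite invr_gt0.
  move=> x0; pose n := (Num.truncn x + Num.truncn x^-1)%N.
  exists n => //=; rewrite in_itv/=; apply/andP; split.
    rewrite -[leRHS]invrK lef_pV2 ?posrE ?invr_gt0//.
    by rewrite (le_trans (ltW (truncnS_gt _)))// ler_nat ltnS leq_addl.
  by rewrite (le_trans (ltW (truncnS_gt _)))// ler_nat ltnS leqW// leq_addr.
have D0 x : (\bigcup_n `[n.+1%:R^-1, n.+2%:R]%classic) x -> 0 < x :> R.
  by rewrite -DE/= in_itv/= andbT.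
rewrite DE.
apply: (@ge0_FTC2_bigcup _ f F (fun n => n.+1%:R^-1) (fun n => n.+2%:R) A B).
- by move=> n; rewrite (@le_lt_trans _ _ 1) ?invf_le1 ?ler1n ?ltr1n.
- by move=> n; rewrite lef_pV2 ?posrE// ler_nat.
- by move=> n; rewrite ler_nat.
- by move=> x /D0; exact: f0.
- by move=> x /D0; exact: cf.
- by move=> x /D0; exact: dF.
- have /cvg_at_rightP := FA; apply; split => [n|]; first by rewrite invr_gt0.
  exact: cvg_harmonic.
- have /cvg_pinftyP := FB; apply.
  apply/cvgryPge => C; exists (Num.truncn C) => // n /= Cn.
  by rewrite (le_trans (ltW (truncnS_gt _)))// ler_nat ltnS leqW.
Qed.

(** * The integral of the inverse Gaussian kernel, through the normal distribution function *)

Definition std_normal_cdf {R : realType} (x : R) : R :=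
  fine (normal_prob 0 1 `]-oo, x]%classic).

Lemma is_derive_std_normal_cdf {R : realType} (x : R) :
  is_derive x 1 std_normal_cdf (normal_pdf 0 1 x).
Proof.
(* The primitive is based at [-oo]; [x + 1] is merely some point to the right of [x]. *)
have [||||] := @continuous_FTC1 R (normal_pdf 0 1) -oo%O x (x + 1).
- by rewrite ltrDl.
- by apply: (integrableS measurableT) => //; exact: integrable_normal_pdf.
- by rewrite ltNyr.
- by apply: continuous_normal_pdf; exact: oner_neq0.
- by move=> dP PE; split; [exact: dP|rewrite -derive1E; exact: PE].
Qed.

Section std_normal_limits.
Context {R : realType}.
(** Under the standard normal law, the identity is a random variable with distribution function
    [std_normal_cdf], so the general limits of distribution functions apply to it. *)
Let idTR : measurableTypeR R -> R := idfun.
#[local] HB.instance Definition _ := @isMeasurableFun.Build _ _ _ _ idTR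
  (@measurable_id _ _ setT).

Lemma cvg_std_normal_cdf_y : std_normal_cdf x @[x --> +oo] --> (1 : R).
Proof.
have := @cvg_cdfy1 _ _ _ (@normal_prob R 0 1)
  (idTR : {RV (@normal_prob R 0 1) >-> R}).
by move=> /fine_cvg.
Qed.

Lemma cvg_std_normal_cdf_Ny : std_normal_cdf x @[x --> -oo] --> (0 : R).
Proof.
have := @cvg_cdfNy0 _ _ _ (@normal_prob R 0 1)
  (idTR : {RV (@normal_prob R 0 1) >-> R}).
by move=> /fine_cvg.
Qed.
End std_normal_limits.

(* An antiderivative of [ig_kernel], in the variable [s = sqrt l], modelled on
   the closed form of the inverse Gaussian distribution function. *)
Definition ig_cdf {R : realType} (c v s : R) : R :=
  c^-1 * (expR (- (c * v)) * std_normal_cdf (c * s - v / s) +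
          expR (c * v) * std_normal_cdf (c * s + v / s)).

(** For nonzero [c] and [v] this is, up to normalization, the density in [l] of a reciprocal inverse
    Gaussian law. *)
Definition ig_kernel {R : realType} (c v l : R) : R :=
  (Num.sqrt (2 * pi * l))^-1 * expR (- (v ^+ 2 / (2 * l)) - c ^+ 2 * l / 2).

Lemma ig_kernel_ge0 {R : realType} (c v l : R) : 0 <= ig_kernel c v l.
Proof. by rewrite mulr_ge0 ?expR_ge0// invr_ge0. Qed.

Lemma continuous_ig_kernel {R : realType} (c v l : R) : 0 < l ->
  {for l, continuous (ig_kernel c v)}.
Proof.
move=> l0; have l20 : 2 * l != 0 by rewrite gt_eqF// mulr_gt0.
have c2l : {for l, continuous (fun l : R => 2 * l)}.
  by apply: cvgM; [exact: cvg_cst|exact: cvg_id].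
apply: cvgM.
  apply: cvgV; first by rewrite gt_eqF// sqrtr_gt0 !mulr_gt0// pi_gt0.
  apply: (continuous_comp (f := fun l : R => 2 * pi * l));
    last exact: sqrt_continuous.
  by apply: cvgM; [exact: cvg_cst|exact: cvg_id].
apply: (continuous_comp
  (f := fun l : R => - (v ^+ 2 / (2 * l)) - c ^+ 2 * l / 2));
  last exact: continuous_expR.
apply: cvgB.
  by apply: cvgN; apply: cvgM; [exact: cvg_cst|exact: cvgV].
apply: cvgM; last exact: cvg_cst.
by apply: cvgM; [exact: cvg_cst|exact: cvg_id].
Qed.

(** Expanding [(c s - v / s)^2] and [(c s + v / s)^2] shows that each normal density times its
    exponential prefactor gives the same exponential. The terms in [v / s^2] then cancel, and the
    remaining [2 c] meets [c^-1] and the derivative [1 / (2 s)] of the square root. *)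
Lemma is_derive_ig_cdf {R : realType} (c v l : R) : 0 < c -> 0 < l ->
  is_derive l 1 (ig_cdf c v \o Num.sqrt) (ig_kernel c v l).
Proof.
move=> c0 l0; set s := Num.sqrt l.
have s0 : 0 < s by rewrite sqrtr_gt0.
have lE : l = s ^+ 2 by rewrite sqr_sqrtr// ltW.
have dc : is_derive s 1 (fun s : R => c * s) c.
  by apply: is_derive_eq; exact: mulr1.
have dv : is_derive s 1 (fun s : R => v / s) (- (v / s ^+ 2)).
  have ds := @is_deriveV _ id s 1 1 (lt0r_neq0 s0) (is_derive_id _ _).
  have := is_deriveM (is_derive_cst (v : R) s 1) ds.
  move/is_derive_eq; apply.
  rewrite scaler0 addr0 /GRing.scale/= mulr1; ring.
have dg1 := is_deriveB dc dv.
have dg2 := is_deriveD dc dv.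
have dP1 := @is_derive1_comp _ _ (fun s => c * s - v / s) s _ _
  (is_derive_std_normal_cdf _) dg1.
have dP2 := @is_derive1_comp _ _ (fun s => c * s + v / s) s _ _
  (is_derive_std_normal_cdf _) dg2.
have dG : is_derive s 1 (ig_cdf c v)
    (c^-1 * (expR (- (c * v)) *
             (normal_pdf 0 1 (c * s - v / s) * (c + v / s ^+ 2)) +
             expR (c * v) *
             (normal_pdf 0 1 (c * s + v / s) * (c - v / s ^+ 2)))).
  have := is_deriveZ c^-1 (is_deriveD (is_deriveZ (expR (- (c * v))) dP1)
    (is_deriveZ (expR (c * v)) dP2)).
  by rewrite opprK.
have := @is_derive1_comp _ _ _ _ _ _ dG (is_derive1_sqrt l0).
move/is_derive_eq; apply.
rewrite /ig_kernel normal_pdfE ?oner_eq0// /normal_peak /normal_fun.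
rewrite !subr0 !expr1n mul1r -/s.
have -> : Num.sqrt (2 * pi * l) = Num.sqrt (pi *+ 2) * s.
  have pi2 : 0 <= pi *+ 2 :> R by rewrite mulrn_wge0// pi_ge0.
  rewrite -(sqrtrM _ pi2).
  by rewrite (_ : 2 * pi * l = pi *+ 2 * l)//; ring.
set N := Num.sqrt (pi *+ 2).
have N0 : N != 0 by rewrite gt_eqF// sqrtr_gt0 mulrn_wgt0// pi_gt0.
have E1 : expR (- (c * v)) * expR (- (c * s - v / s) ^+ 2 / 2) =
    expR (- (v ^+ 2 / (2 * l)) - c ^+ 2 * l / 2).
  by rewrite -expRD lE; congr expR; field; rewrite gt_eqF.
have E2 : expR (c * v) * expR (- (c * s + v / s) ^+ 2 / 2) =
    expR (- (v ^+ 2 / (2 * l)) - c ^+ 2 * l / 2).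
  by rewrite -expRD lE; congr expR; field; rewrite gt_eqF.
transitivity (c^-1 *
  (N^-1 * (expR (- (c * v)) * expR (- (c * s - v / s) ^+ 2 / 2)) *
     (c + v / s ^+ 2) +
   N^-1 * (expR (c * v) * expR (- (c * s + v / s) ^+ 2 / 2)) *
     (c - v / s ^+ 2)) / (2 * s)); first by ring.
rewrite E1 E2; field.
by rewrite N0 (gt_eqF s0) (gt_eqF c0).
Qed.

Lemma cvg_ig_cdf {R : realType} (c v p q : R) (F : set_system R)
    {FF : Filter F} :
  std_normal_cdf (c * s - v / s) @[s --> F] --> p ->
  std_normal_cdf (c * s + v / s) @[s --> F] --> q ->
  ig_cdf c v s @[s --> F] --> c^-1 * (expR (- (c * v)) * p + expR (c * v) * q).
Proof.
move=> cp cq; apply: cvgM; first exact: cvg_cst.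
by apply: cvgD; (apply: cvgM; first exact: cvg_cst).
Qed.

(** Near 0 the term [v / s] dominates: the two normal arguments tend to [-oo] and [+oo], and only
    the second summand survives. *)
Lemma cvg_ig_cdf0 {R : realType} (c v : R) : 0 < c -> 0 < v ->
  ig_cdf c v s @[s --> 0^'+] --> c^-1 * expR (c * v).
Proof.
move=> c0 v0.
have vs C : \forall s \near (0:R)^'+, [/\ 0 < s, s <= 1 & C <= v / s].
  near=> s; have s0 : 0 < s by [].
  split=> //; first by near: s; exact: nbhs_right_le.
  rewrite (le_trans (ler_norm C))// (@le_trans _ _ (`|C| + 1)) ?lerDl//.
  have C1 : 0 < `|C| + 1 by rewrite ltr_wpDl.
  rewrite ler_pdivlMr// mulrC -ler_pdivlMr//.
  by near: s; apply: nbhs_right_le; rewrite divr_gt0.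
have -> : c^-1 * expR (c * v) =
    c^-1 * (expR (- (c * v)) * 0 + expR (c * v) * 1) by ring.
apply: cvg_ig_cdf.
- apply: cvg_comp cvg_std_normal_cdf_Ny; apply/cvgrNyPle => C; near=> s.
  have [s0 s1 Cs] : [/\ 0 < s, s <= 1 & c - C <= v / s] by near: s; exact: vs.
  have : c * s <= c by rewrite ler_piMr// ltW.
  by lra.
- apply: cvg_comp cvg_std_normal_cdf_y; apply/cvgryPge => C; near=> s.
  have [s0 s1 Cs] : [/\ 0 < s, s <= 1 & C <= v / s] by near: s; exact: vs.
  by rewrite (le_trans Cs)// lerDr mulr_ge0// ltW.
Unshelve. all: by end_near. Qed.

(** At infinity [c * s] dominates, so both normal arguments tend to [+oo]. *)
Lemma cvg_ig_cdf_y {R : realType} (c v : R) : 0 < c -> 0 < v ->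
  ig_cdf c v s @[s --> +oo] --> c^-1 * (expR (- (c * v)) + expR (c * v)).
Proof.
move=> c0 v0.
have cs C : \forall s \near +oo%R, [/\ 0 < s, v / s <= v & C <= c * s].
  near=> s; have s1 : 1 <= s by near: s; exact: nbhs_pinfty_ge.
  have s0 : 0 < s by exact: lt_le_trans s1.
  split=> //; first by rewrite ler_pdivrMr// ler_peMr// ltW.
  rewrite mulrC -ler_pdivrMr//; near: s; exact: nbhs_pinfty_ge.
rewrite -[expR (- (c * v))]mulr1 -[X in _ + X]mulr1.
apply: cvg_ig_cdf.
- apply: cvg_comp cvg_std_normal_cdf_y; apply/cvgryPge => C; near=> s.
  have [s0 vs Cs] : [/\ 0 < s, v / s <= v & C + v <= c * s].
    by near: s; exact: cs.
  by lra.
- apply: cvg_comp cvg_std_normal_cdf_y; apply/cvgryPge => C; near=> s.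
  have [s0 vs Cs] : [/\ 0 < s, v / s <= v & C <= c * s] by near: s; exact: cs.
  by rewrite (le_trans Cs)// lerDl divr_ge0// ltW.
Unshelve. all: by end_near. Qed.

Lemma sqrt_cvg0_right {R : realType} : @Num.sqrt R x @[x --> 0^'+] --> 0^'+.
Proof.
move=> P [e /= e0 eP].
suff : \forall x \near (0 : R)^'+, P (Num.sqrt x) by [].
near=> x.
have x0 : 0 < x by [].
have e20 : 0 < e ^+ 2 by rewrite exprn_gt0.
apply: eP; last by rewrite sqrtr_gt0.
rewrite /= sub0r normrN ger0_norm ?sqrtr_ge0//.
rewrite -[ltRHS](gtr0_norm e0) -sqrtr_sqr ltr_sqrt//.
by near: x; apply: nbhs_right_lt; rewrite exprn_gt0.
Unshelve. all: by end_near. Qed.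

Lemma sqrt_cvg_pinfty {R : realType} : @Num.sqrt R x @[x --> +oo] --> +oo.
Proof.
apply/cvgryPge => C.
apply: filterS (nbhs_pinfty_ge (num_real (C ^+ 2))) => x Cx.
by rewrite (le_trans (ler_norm C))// -sqrtr_sqr ler_wsqrtr.
Qed.

(** The kernel depends on [u] only through its square, so [u] may be replaced by [|u| > 0]. The
    growing exponential occurs in the limits of the antiderivative at both ends and cancels. *)
Lemma integral_ig_kernel {R : realType} (c u : R) : 0 < c -> u != 0 ->
  (\int[@lebesgue_measure R]_(l in `]0%R, +oo[) (ig_kernel c u l)%:E =
   (c^-1 * expR (- (c * `|u|)))%:E)%E.
Proof.
move=> c0 u0; have v0 : 0 < `|u| by rewrite normr_gt0.
have -> : ig_kernel c u = ig_kernel c `|u|.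
  by apply/funext => l; rewrite /ig_kernel real_normK// num_real.
set A := c^-1 * expR (c * `|u|).
set B := c^-1 * (expR (- (c * `|u|)) + expR (c * `|u|)).
have -> : c^-1 * expR (- (c * `|u|)) = B - A by rewrite /A /B; ring.
apply: (@ge0_FTC2_0y R (ig_kernel c `|u|) (ig_cdf c `|u| \o Num.sqrt) A B).
- by move=> l _; exact: ig_kernel_ge0.
- by move=> l; exact: continuous_ig_kernel.
- by move=> l l0; exact: is_derive_ig_cdf.
- exact: cvg_comp sqrt_cvg0_right (cvg_ig_cdf0 _ _ c0 v0).
- exact: cvg_comp sqrt_cvg_pinfty (cvg_ig_cdf_y _ _ c0 v0).
Qed.

(** * Exchange of sum and integral *)

(** Dominated convergence for the partial sums, with [g], the sum of the absolute values, as bound.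
    Monotone convergence gives [g] the integral [limn (series I)], which is finite because
    [series I] converges. *)
Lemma integral_series {d} {T : measurableType d} {R : realType}
    (mu : {measure set T -> \bar R}) (D : set T) (f : nat -> T -> R)
    (I J : R^nat) :
  measurable D -> (forall k, measurable_fun D (f k)) ->
  (forall x, D x -> cvgn (series (f ^~ x))) ->
  (forall k, \int[mu]_(x in D) `|f k x|%:E = (I k)%:E)%E -> cvgn (series I) ->
  (forall k, \int[mu]_(x in D) (f k x)%:E = (J k)%:E)%E ->
  (\int[mu]_(x in D) (limn (series (f ^~ x)))%:E = (limn (series J))%:E)%E.
Proof.
move=> mD mf cf fI cI fJ.
pose g x := (\sum_(k <oo) `|f k x|%:E)%E.
pose S n x := (series (f ^~ x) n)%:E.
have mnf k : measurable_fun D (fun x => `|f k x|%:E).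
  by apply/measurable_EFinP; exact: measurableT_comp.
have g0 x : (0 <= g x)%E by apply: nneseries_ge0 => k _ _; rewrite lee_fin.
have ig : mu.-integrable D g.
  apply/integrableP; split.
    apply: ge0_emeasurable_sum => // k x _ _; by rewrite lee_fin.
  under eq_integral do rewrite gee0_abs//.
  rewrite integral_nneseries//.
  under eq_eseriesr do rewrite fI.
  have -> : (\sum_(k <oo) (I k)%:E = (limn (series I))%:E)%E.
    rewrite -EFin_lim//; congr (limn _); apply/funext => n /=.
    by rewrite sumEFin.
  by rewrite ltry.
have if_ k : mu.-integrable D (EFin \o f k).
  apply/integrableP; split; first exact/measurable_EFinP.
  by rewrite fI ltry.
have mS n : measurable_fun D (fun x => series (f ^~ x) n).
  by apply: measurable_sum.
have cS x : D x -> S ^~ x @ \oo --> (limn (series (f ^~ x)))%:E.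
  by move=> Dx; apply: cvg_EFin; [exact: nearW|exact: cf].
have mlim : measurable_fun D (fun x => limn (series (f ^~ x))).
  by apply: (measurable_fun_cvg mS) => x Dx; exact: cf.
have Sg x n : (`|S n x| <= g x)%E.
  rewrite /S abse_EFin (@le_trans _ _ (\sum_(0 <= k < n) `|f k x|%:E)%E)//.
    by rewrite sumEFin lee_fin ler_norm_sum.
  by apply: nneseries_lim_ge => k _ _; rewrite lee_fin.
have aeS : {ae mu, forall x, D x ->
    S ^~ x @ \oo --> (limn (series (f ^~ x)))%:E}.
  exact: aeW.
have aeg : {ae mu, forall x n, D x -> (`|S n x| <= g x)%E}.
  by apply: aeW => x n _; exact: Sg.
have mSE n : measurable_fun D (S n) by exact/measurable_EFinP.
have mlimE : measurable_fun D (fun x => (limn (series (f ^~ x)))%:E).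
  exact/measurable_EFinP.
have [iF _] := dominated_convergence mD mSE mlimE aeS ig aeg.
rewrite (_ : [sequence _]_n = EFin \o series J); last first.
  apply/funext => n /=; rewrite /S /series/= -sumEFin.
  rewrite -(eq_bigr _ (fun k _ => fJ k)) -integral_sum//.
  by apply: eq_integral => x _; rewrite sumEFin.
have /fineK <- := integrable_fin_num mD iF.
by move=> /fine_cvgP[_ /cvg_lim] <-.
Qed.

(** * Convergence of the series that defines the Polya density *)

Lemma is_cvg_pseries_norm_real_binomial {R : realType} (r z : R) :
  `|z| < 1 -> cvgn (pseries (fun k => `|real_binomial r k|) z).
Proof.
move=> z1; pose x := (`|z| + 1) / 2.
have x0 : 0 <= x by rewrite divr_ge0// addr_ge0.
apply: (@is_cvg_pseries_inside_norm _ _ x).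
  by apply: is_cvg_pseries_real_binomial; rewrite (ger0_norm x0) /x; lra.
by rewrite (ger0_norm x0) /x; lra.
Qed.

(** This is [z] times a formally differentiated power series, whose coefficients are [|r|] times the
    absolute binomial coefficients for [r - 1]. It handles the factor [k] in [delta + k]. *)
Lemma is_cvg_series_natM_norm_real_binomial {R : realType} (r z : R) :
  `|z| < 1 -> cvgn (series (fun k => k%:R * `|real_binomial r k| * z ^+ k)).
Proof.
move=> z1.
have cd : cvgn (pseries (pseries_diffs (fun k => `|real_binomial r k|)) z).
  have -> : pseries_diffs (fun k => `|real_binomial r k|) =
      `|r| *: (fun k => `|real_binomial (r - 1) k|).
    apply/funext => k; rewrite /pseries_diffs !fctE /GRing.scale/= -normrM.
    have /(congr1 (fun f => f k)) := real_binomial_diffs r.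
    rewrite /pseries_diffs !fctE /GRing.scale/= => <-.
    by rewrite [RHS]normrM normr_nat.
  rewrite (_ : pseries _ _ =
      `|r| *: pseries (fun k => `|real_binomial (r - 1) k|) z).
    by apply: is_cvgZl_tmp; exact: is_cvg_pseries_norm_real_binomial.
  rewrite /pseries -seriesZ; congr series; apply/funext => k.
  by rewrite !fctE scalerAl.
rewrite (_ : (fun k => _) =
    z *: (fun k => k%:R * `|real_binomial r k| * z ^+ k.-1)).
  by apply: is_cvg_seriesZ; exact: is_cvg_pseries_diffs_equiv.
apply/funext => -[|k]; rewrite !fctE /GRing.scale/=.
  by rewrite !mul0r mulr0.
by rewrite exprS; ring.
Qed.

(** Since [polya_psi a b k = a b + 2 delta k + k^2 >= 2 delta k], the exponential is at most [x ^ k]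
    with [x = exp(- delta l) < 1]. The weights are then handled by the two absolutely convergent
    binomial series above. *)
Lemma is_cvg_polya_density {R : realType} (a b l : R) :
  0 < a -> 0 < b -> 0 < l ->
  cvgn (series (fun k : nat =>
    polya_weight a b k * expR (- (1 / 2) * polya_psi a b k * l))).
Proof.
move=> a0 b0 l0; pose x := expR (- ((a + b) / 2 * l)).
have x0 : 0 <= x by exact: expR_ge0.
have x1 : `|x| < 1.
  rewrite ger0_norm// -expR0 ltr_expR oppr_lt0.
  by rewrite !mulr_gt0// addr_gt0.
rewrite /polya_weight; set delta := (a + b) / 2; set B := Beta _ _.
have d0 : 0 < delta by rewrite divr_gt0// addr_gt0.
set rb := real_binomial _.
have c1 : cvgn (series (fun k =>
    delta * (`|rb k| * x ^+ k) + k%:R * `|rb k| * x ^+ k)).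
  apply: is_cvg_seriesD; last exact: is_cvg_series_natM_norm_real_binomial.
  by apply: is_cvg_seriesZ; exact: is_cvg_pseries_norm_real_binomial.
apply: normed_cvg; apply: (@series_le_cvg _ _ (fun k =>
    `|B^-1| * (delta * (`|rb k| * x ^+ k) + k%:R * `|rb k| * x ^+ k)))
    => [k|k|k|]; [exact: normr_ge0| | |exact: is_cvg_seriesZ].
  by rewrite mulr_ge0// addr_ge0// !mulr_ge0// ?exprn_ge0// addr_ge0// ltW.
have dk0 : 0 <= delta + k%:R by rewrite addr_ge0// ltW.
rewrite /= normrM (ger0_norm (expR_ge0 _)) normrM.
rewrite [`|(delta + _) / B|]normrM (ger0_norm dk0).
have -> : `|B^-1| * (delta * (`|rb k| * x ^+ k) + k%:R * `|rb k| * x ^+ k) =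
  `|rb k| * ((delta + k%:R) * `|B^-1|) * x ^+ k by ring.
rewrite ler_wpM2l ?mulr_ge0//.
rewrite /x -expRM_natl ler_expR /polya_psi /delta.
suff : 0 <= (a * b + k%:R ^+ 2) * l by lra.
by rewrite mulr_ge0 ?(ltW l0)// addr_ge0 ?exprn_ge0// mulr_ge0// ltW.
Qed.

(** * The inner integral as a generalized logistic density *)

Lemma measurable_ig_kernel {R : realType} (c u : R) :
  measurable_fun (`]0%R, +oo[%classic : set R) (ig_kernel c u).
Proof.
apply: open_continuous_measurable_fun; first exact: interval_open.
by move=> l; rewrite inE/= in_itv/= andbT => l0; exact: continuous_ig_kernel.
Qed.

Lemma integrable_ig_kernel {R : realType} (c u : R) : 0 < c -> u != 0 ->
  (@lebesgue_measure R).-integrable `]0, +oo[ (EFin \o ig_kernel c u).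
Proof.
move=> c0 u0; apply/integrableP; split.
  by apply/measurable_EFinP; exact: measurable_ig_kernel.
under eq_integral do rewrite /= ger0_norm ?ig_kernel_ge0//.
by rewrite integral_ig_kernel// ltry.
Qed.

(** With [theta = (a - b) / 2], the cross term of the square gives [exp(theta u)], while its
    [- theta^2 l / 2] completes [polya_psi a b k] to a square. *)
Lemma ig_kernel_decomp {R : realType} (a b u l : R) (k : nat) : 0 < l ->
  (Num.sqrt (2 * pi * l))^-1 *
    expR (- (1 / (2 * l)) * (u - 1 / 2 * (a - b) * l) ^+ 2) *
    expR (- (1 / 2) * polya_psi a b k * l) =
  expR ((a - b) / 2 * u) * ig_kernel ((a + b) / 2 + k%:R) u l.
Proof.
move=> l0; rewrite /ig_kernel -mulrA [RHS]mulrCA -!expRD; congr (_ * _).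
by congr expR; rewrite /polya_psi; field; rewrite gt_eqF.
Qed.

Lemma polya_mixture {R : realType} (a b u : R) : 0 < a -> 0 < b -> u != 0 ->
  (\int[@lebesgue_measure R]_(l in `]0%R, +oo[)
    ((Num.sqrt (2 * pi * l))^-1 *
      expR (- (1 / (2 * l)) * (u - 1 / 2 * (a - b) * l) ^+ 2) *
      polya_density a b l)%:E =
   ((Beta a b)^-1 * (expR (a * u) * (1 + expR u) `^ (- (a + b))))%:E)%E.
Proof.
move=> a0 b0 u0; pose d := (a + b) / 2; pose h := (a - b) / 2.
have d0 : 0 < d by rewrite divr_gt0// addr_gt0.
have dk k : 0 < d + k%:R by rewrite ltr_wpDr.
pose w := polya_weight a b.
pose f k l := w k * expR (h * u) * ig_kernel (d + k%:R) u l.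
(* The assumption [u != 0] places [x] strictly inside the disc of convergence of the binomial
   series. *)
pose x := expR (- `|u|).
have x0 : 0 <= x by exact: expR_ge0.
have x1 : `|x| < 1.
  by rewrite ger0_norm// -expR0 ltr_expR oppr_lt0 normr_gt0.
pose C := (Beta a b)^-1 * expR (h * u - d * `|u|).
pose rb := real_binomial (- (a + b)).
pose J k := C * (rb k * x ^+ k).
have wE k : w k = rb k * ((d + k%:R) / Beta a b).
  rewrite /w /polya_weight -/d -/h.
  have -> : d + h = a by rewrite /d /h; field.
  have -> : d - h = b by rewrite /d /h; field.
  by have -> : 2 * d = a + b by rewrite /d; field.
have kE k : expR (- ((d + k%:R) * `|u|)) = expR (- (d * `|u|)) * x ^+ k.
  by rewrite /x -expRM_natl -expRD; congr expR; ring.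
(* The factor [d + k] of the weight cancels the [1 / (d + k)] from the kernel integral, leaving a
   pure binomial term. *)
have JE k : w k * expR (h * u) * ((d + k%:R)^-1 * expR (- ((d + k%:R) * `|u|)))
    = J k.
  rewrite kE wE /J /C expRD.
  transitivity ((d + k%:R) / (d + k%:R) * ((Beta a b)^-1 *
    (expR (h * u) * expR (- (d * `|u|))) * (rb k * x ^+ k))); first by ring.
  by rewrite divff ?mul1r// gt_eqF.
have cJ : cvgn (series (fun k => `|J k|)).
  rewrite (_ : (fun k => _) = `|C| *: (fun k => `|rb k| * x ^+ k)).
    by apply: is_cvg_seriesZ; exact: is_cvg_pseries_norm_real_binomial.
  apply/funext => k; rewrite /J normrM [`|rb k * _|]normrM normrX.
  by rewrite (ger0_norm x0).
have mf k : measurable_fun (`]0%R, +oo[%classic : set R) (f k).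
  by apply: measurable_funM => //; exact: measurable_ig_kernel.
have If k : (\int[@lebesgue_measure R]_(l in `]0%R, +oo[) (f k l)%:E =
    (J k)%:E)%E.
  under eq_integral do rewrite /f EFinM.
  rewrite integralZl//; last exact: integrable_ig_kernel.
  by rewrite integral_ig_kernel// -EFinM JE.
have Inf k : (\int[@lebesgue_measure R]_(l in `]0%R, +oo[) `|f k l|%:E =
    `|J k|%:E)%E.
  under eq_integral
    do rewrite /f normrM (ger0_norm (ig_kernel_ge0 _ _ _)) EFinM.
  rewrite integralZl//; last exact: integrable_ig_kernel.
  rewrite integral_ig_kernel// -EFinM -JE [`|_ * (_^-1 * _)|]normrM.
  rewrite [`|_^-1 * _|]ger0_norm// mulr_ge0 ?expR_ge0// invr_ge0 ltW//.
have fE l : 0 < l -> series (f ^~ l) =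
    ((Num.sqrt (2 * pi * l))^-1 *
      expR (- (1 / (2 * l)) * (u - 1 / 2 * (a - b) * l) ^+ 2)) *:
    series (fun k => w k * expR (- (1 / 2) * polya_psi a b k * l)).
  move=> l0; rewrite -seriesZ; congr series; apply/funext => k.
  rewrite /f -mulrA -(ig_kernel_decomp a b u l k l0).
  by rewrite [LHS]mulrCA.
transitivity (\int[@lebesgue_measure R]_(l in `]0%R, +oo[)
    (limn (series (f ^~ l)))%:E)%E.
  apply: eq_integral => l; rewrite inE/= in_itv/= andbT => l0.
  by rewrite fE// limZl_tmp//; exact: is_cvg_polya_density.
have cf (l : R) : `]0, +oo[%classic l -> cvgn (series (f ^~ l)).
  rewrite /= in_itv/= andbT => l0; rewrite fE//.
  by apply: is_cvgZl_tmp; exact: is_cvg_polya_density.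
rewrite (@integral_series _ (measurableTypeR R) R lebesgue_measure _ f _ J
  (measurable_itv `]0, +oo[) mf cf Inf cJ If).
congr EFin.
rewrite (_ : series J = C *: pseries rb x); last by rewrite -seriesZ.
rewrite limZl_tmp; last exact: is_cvg_pseries_real_binomial.
rewrite (binomial_series _ _ x1) /C /GRing.scale/= -mulrA; congr (_ * _).
(* For [u < 0] the prefactor exponent is [(h + d) u = a u]. For [u >= 0] it is [(h - d) u = - b u],
   and pulling [exp(- u)] out of the power contributes the missing [(a + b) u]. *)
have [u_lt0|u_ge0] := ltP u 0.
  rewrite /x (ltr0_norm u_lt0) opprK; congr (expR _ * _).
  by rewrite /h /d; field.
rewrite /x (ger0_norm u_ge0).
have -> : 1 + expR (- u) = expR (- u) * (1 + expR u).
  by rewrite mulrDr mulr1 -expRD addNr expR0 addrC.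
rewrite powRM ?expR_ge0 ?addr_ge0 ?expR_ge0// mulrA.
congr (_ * _).
by rewrite -expRM -expRD; congr expR; rewrite /h /d; field.
Qed.

(** * The case [a = 1]: the Beta constant and the outer logistic integral *)

Lemma is_derive_continuous {R : realType} (f : R -> R) (x df : R) :
  is_derive x 1 f df -> {for x, continuous f}.
Proof. by case=> fx _; exact/differentiable_continuous/derivable1_diffP. Qed.

Lemma is_derive_powR_onem {R : realType} (b t : R) : t < 1 ->
  is_derive t 1 (fun t : R => (1 - t) `^ b) (- (b * (1 - t) `^ (b - 1))).
Proof.
move=> t1; have t0 : 0 < 1 - t by rewrite subr_gt0.
have := is_deriveB (is_derive_cst (1 : R) t 1) (is_derive_id t 1).
rewrite sub0r => d1.
have := @is_derive1_comp _ _ (fun t => 1 - t) t _ _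
  (@is_derive1_powR _ b _ t0) d1.
by rewrite mulrN1.
Qed.

(** The factor [t ^ 0] is 1, so [- (1 - t)^b / b] is an antiderivative; it rises from [- 1 / b] at 0
    to 0 at 1. For [b < 1] the integrand is unbounded near 1, hence the exhaustion of the open
    interval. *)
Lemma Beta1l {R : realType} (b : R) : 0 < b -> Beta 1 b = b^-1.
Proof.
move=> b0; rewrite /Beta /Rintegral.
(* Starting at [1 / 3] ensures [an n < 1 - an n] for every [n]. *)
pose an (n : nat) : R := n.+3%:R^-1; pose bn n := 1 - an n.
have an0 n : 0 < an n by rewrite invr_gt0.
have an3 n : an n <= 3^-1 by rewrite lef_pV2 ?posrE// ler_nat.
have anS n : an n.+1 <= an n by rewrite lef_pV2 ?posrE// ler_nat.
have can : an n @[n --> \oo] --> 0.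
  by have := @cvg_harmonic R; rewrite -2!cvg_shiftS.
have DE : `]0, 1[%classic = \bigcup_n `[an n, bn n]%classic :> set R.
  apply/seteqP; split=> [t /=|t [n _] /=]; rewrite !in_itv/=; last first.
    by move=> /andP[at_ tb]; have := an0 n; move: tb; rewrite /bn; lra.
  move=> /andP[t0 t1].
  have [n _ nP] : \forall n \near \oo, an n <= Num.min t (1 - t).
    have tt : 0 < Num.min t (1 - t) by rewrite lt_min t0 subr_gt0.
    by near=> n; apply: ltW; near: n; exact: cvgr_lt can _ tt.
  exists n => //=; rewrite in_itv/=; have := nP n (leqnn n).
  by rewrite le_min /bn => /andP[-> ?]; lra.
pose F t : R := - b^-1 * (1 - t) `^ b.
have dF (t : R) : t < 1 -> is_derive t 1 F (t `^ (1 - 1) * (1 - t) `^ (b - 1)).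
  move=> t1; rewrite subrr powRr0 mul1r.
  have := is_deriveZ (- b^-1) (is_derive_powR_onem b t t1).
  move/is_derive_eq; apply; rewrite /GRing.scale/=; field.
  by rewrite gt_eqF.
have D01 (t : R) : (\bigcup_n `[an n, bn n]%classic) t -> 0 < t < 1.
  by rewrite -DE /= in_itv.
rewrite DE -[RHS]/(fine (b^-1)%:E); congr fine.
rewrite -[b^-1]opprK -[- - b^-1]sub0r.
apply: (@ge0_FTC2_bigcup R (fun t => t `^ (1 - 1) * (1 - t) `^ (b - 1)) F an bn).
- by move=> n; have := an3 n; rewrite /bn; lra.
- exact: anS.
- by move=> n; have := anS n; rewrite /bn; lra.
- by move=> t _; rewrite mulr_ge0// powR_ge0.
- move=> t /D01/andP[t0 t1]; rewrite subrr.
  rewrite (_ : (fun _ => _) = (fun t : R => (1 - t) `^ (b - 1))); last first.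
    by apply/funext => s; rewrite powRr0 mul1r.
  exact: is_derive_continuous (is_derive_powR_onem (b - 1) t t1).
- by move=> t /D01/andP[_]; exact: dF.
- have <- : F 0 = - b^-1 by rewrite /F subr0 powR1 mulr1.
  by apply: cvg_comp can (is_derive_continuous _ _ _ (dF 0 ltr01)).
- rewrite (_ : (fun n => _) = (fun n => - b^-1 * an n `^ b)); last first.
    by apply/funext => n; rewrite /F /bn subKr.
  rewrite -(mulr0 (- b^-1)); apply: cvgM; first exact: cvg_cst.
  have /cvg_at_rightP := @powR_cvg0 _ _ b0; apply; split => //.
Unshelve. all: by end_near. Qed.

(** The differentiated function is minus the survival function of a generalized logistic law with
    location [m]. *)
Lemma is_derive_logistic_survival {R : realType} (kappa m z : R) :
  is_derive z 1 (fun z : R => - (1 + expR (z - m)) `^ (- kappa))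
    (kappa * (expR (z - m) * (1 + expR (z - m)) `^ (- (1 + kappa)))).
Proof.
have e0 : 0 < 1 + expR (z - m) by rewrite addr_gt0// expR_gt0.
have d1 : is_derive z 1 (fun z => z - m) 1.
  have := is_deriveB (is_derive_id z 1) (is_derive_cst (m : R) z 1).
  by rewrite subr0.
have d2 := @is_derive1_comp _ expR (fun z => z - m) z _ _ (is_derive_expR _) d1.
have d3 := is_deriveD (is_derive_cst (1 : R) z 1) d2.
have := is_deriveN (@is_derive1_comp _ _ (fun z => 1 + expR (z - m)) z _ _
  (@is_derive1_powR _ (- kappa) _ e0) d3).
move/is_derive_eq; apply.
have -> : - (1 + kappa) = - kappa - 1 by ring.
by rewrite add0r mulr1; ring.
Qed.

(** Since [1 + exp(z - m) >= exp(z - m)], the power lies between 0 and [exp(- kappa (z - m))]. *)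
Lemma cvg_logistic_survival {R : realType} (kappa m : R) : 0 < kappa ->
  - (1 + expR (z - m)) `^ (- kappa) @[z --> +oo] --> 0.
Proof.
move=> k0; rewrite -oppr0; apply: cvgN.
apply: (@squeeze_cvgr _ _ _ _ (cst 0) (fun z => expR (- (kappa * (z - m))))).
- near=> z; rewrite powR_ge0/= mulrC -mulrN expRM.
  rewrite !powRN lef_pV2 ?posrE ?powR_gt0 ?expR_gt0 ?addr_gt0//;
    last exact: expR_gt0.
  apply: ge0_ler_powR; rewrite ?nnegrE ?addr_ge0 ?expR_ge0 ?lerDr ?(ltW k0)//.
- exact: cvg_cst.
- apply: (cvg_comp (fun z => kappa * (z - m)) (fun z => expR (- z)));
    last exact: cvgr_expR.
  apply/cvgryPge => C.
  apply: filterS (nbhs_pinfty_ge (num_real (C / kappa + m))) => z.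
  by rewrite -lerBrDr ler_pdivrMr// mulrC.
Unshelve. all: by end_near. Qed.

Lemma continuous_logistic_density {R : realType} (kappa m : R) :
  continuous (fun z : R =>
    kappa * (expR (z - m) * (1 + expR (z - m)) `^ (- (1 + kappa)))).
Proof.
move=> z; apply: cvgM; first exact: cvg_cst.
have ce : expR (t - m) @[t --> z] --> expR (z - m).
  apply: (continuous_comp (f := fun t : R => t - m));
    last exact: continuous_expR.
  by apply: cvgB; [exact: cvg_id|exact: cvg_cst].
apply: cvgM => //.
have e0 : 0 < 1 + expR (z - m) by rewrite addr_gt0// expR_gt0.
have c1 : 1 + expR (t - m) @[t --> z] --> 1 + expR (z - m).
  by apply: cvgD => //; exact: cvg_cst.
exact: cvg_comp c1 (is_derive_continuous _ _ _
  (@is_derive1_powR _ (- (1 + kappa)) _ e0)).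
Qed.

Lemma integral_logistic {R : realType} (kappa m : R) : 0 < kappa ->
  (\int[@lebesgue_measure R]_(z in `]0%R, +oo[)
    (kappa * (expR (z - m) * (1 + expR (z - m)) `^ (- (1 + kappa))))%:E =
   ((1 + expR (- m)) `^ (- kappa))%:E)%E.
Proof.
move=> k0.
have -> : (1 + expR (- m)) `^ (- kappa) = 0 - - (1 + expR (0 - m)) `^ (- kappa).
  by rewrite !sub0r opprK.
pose f z := kappa * (expR (z - m) * (1 + expR (z - m)) `^ (- (1 + kappa))).
apply: (@ge0_FTC2_0y R f (fun z : R => - (1 + expR (z - m)) `^ (- kappa))).
- by move=> z _; rewrite !mulr_ge0 ?expR_ge0 ?powR_ge0 ?ltW.
- by move=> z _; exact: continuous_logistic_density.
- by move=> z _; exact: is_derive_logistic_survival.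
- apply: cvg_at_right_filter.
  exact: is_derive_continuous (is_derive_logistic_survival kappa m 0).
- exact: cvg_logistic_survival.
Qed.

Theorem theorem1 (R : realType) (kappa : R) (p : nat) (x beta : 'cV[R]_p) (y : R)
    (kappa_gt0 : 0 < kappa) (p_ge1 : (1 <= p)%N) (y_pm1 : y = -1 \/ y = 1) :
  let xb : R := (x^T *m beta) 0 0 in
  ((1 + expR (- y * xb)) `^ (- kappa))%:E =
  (\int[@lebesgue_measure R]_(z in `]0%R, +oo[)
    \int[@lebesgue_measure R]_(lambda in `]0%R, +oo[)
      ((Num.sqrt (2 * pi * lambda))^-1 *
       expR (- (1 / (2 * lambda)) *
             (z - y * xb - 1 / 2 * (1 - kappa) * lambda) ^+ 2) *
       polya_density 1 kappa lambda)%R%:E)%E.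
Proof.
move=> xb; set m := y * xb; rewrite mulNr -/m.
rewrite -(integral_logistic kappa m kappa_gt0).
set G := (fun z => (kappa * _)%:E); set H := (fun z => integral _ _ _).
(* At [z = m] the inner variable [u = z - m] vanishes and [polya_mixture] does not apply; this
   single point is removed from both integrals. *)
pose D : set R := `]0%R, +oo[%classic `\ m.
have mD : measurable D by exact: measurableD.
have HG : {in D, H =1 G}.
  move=> z; rewrite inE => -[_ /= zm].
  rewrite /H polya_mixture// ?subr_eq0; last exact/eqP.
  by rewrite Beta1l// invrK mul1r.
have mG : measurable_fun D G.
  apply/measurable_EFinP.
  apply: measurable_funS (_ : measurable_fun setT _) => //.
  apply: continuous_measurable_fun => z; exact: continuous_logistic_density.
(* Measurability of the inner integral in [z] is inherited from its continuous closed form, with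
   which it agrees on [D]. *)
have mH : measurable_fun D H.
  by apply: eq_measurable_fun mG => z zD; rewrite HG.
rewrite -(integral_setD1 mD mG) -(integral_setD1 mD mH).
by apply: eq_integral => z zD; rewrite HG.
Qed.
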